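(* Let $\Gamma$ be a directed graph with a linear order $\prec$ on its set of edges $E(\Gamma)$. Then the following conditions are equivalent (each for any three distinct edges $e_1,e_2,e_3$): $(P_2)$ if $e_1\to e_2$ and $e_1\prec e_3\prec e_2$, then $e_3\to e_2$ or $e_1\to e_3$; $(P_2^r)$ if $e_1\to e_2$, $e_1\prec e_3$ and $e_1\nrightarrow e_3$, then $e_2\prec e_3$ or $e_3\to e_2$; $(P_2^l)$ if $e_1\to e_2$, $e_3\prec e_2$ and $e_3\nrightarrow e_2$, then $e_3\prec e_1$ or $e_1\to e_3$; $(\widetilde{P_2})$ if $e_1e_2$ is a directed path, that is, $t(e_1)=s(e_2)$, and $e_1\prec e_3\prec e_2$, then $e_3\to e_2$ or $e_1\to e_3$; $(\widetilde{P_2^r})$ if $e_1e_2$ is a directed path, $e_1\prec e_3$ and $e_1\nrightarrow e_3$, then $e_2\prec e_3$ or $e_3\to e_2$; $(\widetilde{P_2^l})$ if $e_1e_2$ is a directed path, $e_3\prec e_2$ and $e_3\nrightarrow e_2$, then $e_3\prec e_1$ or $e_1\to e_3$.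
   Context: A graph is a triple $(H,P,\sigma)$ with $H$ a finite set (half-edges), $P$ a partition of $H$ into nonempty blocks (vertices), $\sigma$ an involution of $H$ (its orbits are the edges), such that a vertex containing a two-element $\sigma$-orbit equals that orbit. An orientation $\mathrm{sgn}:H\to\{+,-\}$ takes different values on the two elements of each two-element orbit. The graph is directed if every vertex contains at least one half-edge of sign $+$ and at least one of sign $-$. The source $s(e)$ (target $t(e)$) of an edge $e$ is the vertex containing its half-edge of sign $-$ ($+$), if there is one. A directed path is a sequence of edges $e_1,\dots,e_n$, $n\ge1$, with $t(e_i)=s(e_{i+1})$ for $1\le i\le n-1$; $e\to e'$ means there is a directed path starting with $e$ and ending with $e'$, and $e\nrightarrow e'$ means there is none. *)

(* Defs.v *)
From mathcomp Require Import all_boot.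

Set Implicit Arguments.
Unset Strict Implicit.
Unset Printing Implicit Defensive.

Definition edge_set (H : finType) (sigma : H -> H) : {set {set H}} :=
  [set [set x in orbit sigma h] | h : H].

(* Fixed points of [inv] are allowed: they are the one-element edges. *)
Record graph := Graph {
  half_edge : finType;
  vertices : {set {set half_edge}};
  inv : half_edge -> half_edge;
  vertices_partition : partition vertices [set: half_edge];
  inv_involutive : involutive inv;
  vertex_full_edge : forall v e : {set half_edge},
    v \in vertices -> e \in edge_set inv -> #|e| = 2 -> e \subset v -> v = e
}.

(* Signs are booleans: [true] is +, [false] is -. *)
Definition orientation (G : graph) (sgn : half_edge G -> bool) : Prop :=
  forall e : {set half_edge G}, e \in edge_set (@inv G) -> #|e| = 2 ->
  forall h h' : half_edge G, h \in e -> h' \in e -> h != h' -> sgn h != sgn h'.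

Record digraph := Digraph {
  digraph_graph :> graph;
  sgn : half_edge digraph_graph -> bool;
  sgn_orientation : orientation sgn;
  digraph_directed : forall v, v \in vertices digraph_graph ->
    (exists2 h, h \in v & sgn h = true) /\ (exists2 h, h \in v & sgn h = false)
}.

Section Digraph.

Variable G : digraph.

Definition edge : Type := {e : {set half_edge G} | e \in edge_set (@inv G)}.

(* The vertex containing the half-edge of [e] of sign [b]; it is unique when it
   exists, by [endpointP]. *)
Definition endpoint (b : bool) (e : edge) : option {set half_edge G} :=
  [pick v in vertices G | [exists h in val e, (h \in v) && (sgn h == b)]].

Definition source (e : edge) := endpoint false e.
Definition target (e : edge) := endpoint true e.

(* The bare equality [target e == source e'] would also hold when both are
   undefined, hence the explicit vertex. *)
Definition composable (e e' : edge) : bool :=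
  [exists v, (target e == Some v) && (source e' == Some v)].

Definition reaches (e e' : edge) : Prop :=
  exists2 p : seq edge, path composable e p & last e p = e'.

Definition strict_linear_order (prec : rel edge) : Prop :=
  [/\ irreflexive prec, transitive prec
    & forall e e' : edge, e != e' -> prec e e' || prec e' e].

Local Notation "e --> e'" := (reaches e e') (at level 70, no associativity).

Section Conditions.

Variable prec : rel edge.
Local Notation "e '≺' e'" := (prec e e') (at level 70, no associativity).

Definition P2 : Prop := forall e1 e2 e3 : edge, uniq [:: e1; e2; e3] ->
  e1 --> e2 -> e1 ≺ e3 -> e3 ≺ e2 -> e3 --> e2 \/ e1 --> e3.

Definition P2r : Prop := forall e1 e2 e3 : edge, uniq [:: e1; e2; e3] ->
  e1 --> e2 -> e1 ≺ e3 -> ~ e1 --> e3 -> e2 ≺ e3 \/ e3 --> e2.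

Definition P2l : Prop := forall e1 e2 e3 : edge, uniq [:: e1; e2; e3] ->
  e1 --> e2 -> e3 ≺ e2 -> ~ e3 --> e2 -> e3 ≺ e1 \/ e1 --> e3.

Definition P2_tilde : Prop := forall e1 e2 e3 : edge, uniq [:: e1; e2; e3] ->
  composable e1 e2 -> e1 ≺ e3 -> e3 ≺ e2 -> e3 --> e2 \/ e1 --> e3.

Definition P2r_tilde : Prop := forall e1 e2 e3 : edge, uniq [:: e1; e2; e3] ->
  composable e1 e2 -> e1 ≺ e3 -> ~ e1 --> e3 -> e2 ≺ e3 \/ e3 --> e2.

Definition P2l_tilde : Prop := forall e1 e2 e3 : edge, uniq [:: e1; e2; e3] ->
  composable e1 e2 -> e3 ≺ e2 -> ~ e3 --> e2 -> e3 ≺ e1 \/ e1 --> e3.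

End Conditions.

Lemma edge_sign_inj (e : edge) : {in val e &, injective (@sgn G)}.
Proof.
case: e => e /= He h h' hin h'in hh'; apply/eqP/negPn/negP => neq.
have /(_ _) Hs := @sgn_orientation G e He _ h h' hin h'in neq.
suff c2 : #|e| = 2 by move: (Hs c2); rewrite hh' eqxx.
have sub : forall x, x \in e -> forall y, y \in e -> y = x \/ y = inv x.
  have /imsetP[k _ ->] := He.
  have orb z : z \in orbit (@inv G) k -> z = k \/ z = inv k.
    rewrite -fconnect_orbit => /iter_findex <-.
    elim: (findex _ _ _) => [|n IH] /=; first by left.
    by case: IH => ->; [right | left; rewrite inv_involutive].
  move=> x; rewrite inE => /orb xk y; rewrite inE => /orb yk.
  by case: xk yk => -> [] ->; rewrite ?inv_involutive; auto.
have -> : e = [set h; h'].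
  apply/setP => y; rewrite !inE; apply/idP/idP => [yin|/orP[]/eqP-> //].
  have [e1|e1] := sub h hin h' h'in; first by rewrite e1 eqxx in neq.
  by have [->|->] := sub h hin y yin; rewrite ?eqxx // -e1 eqxx orbT.
by rewrite cards2 neq.
Qed.

Lemma endpointP (b : bool) (e : edge) (v : {set half_edge G}) :
  endpoint b e = Some v <->
  v \in vertices G /\ exists h, [/\ h \in val e, h \in v & sgn h = b].
Proof.
rewrite /endpoint; split.
  case: pickP => // w /andP[wV /existsP[h /and3P[he hw /eqP hb]]] [<-].
  by split=> //; exists h.
case=> vV [h [he hv hb]]; case: pickP => [w|/(_ v)].
  case/andP=> wV /existsP[h' /and3P[h'e h'w /eqP h'b]]; congr Some.
  have eqh : h' = h by apply: (edge_sign_inj h'e he); rewrite h'b hb.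
  rewrite {}eqh in h'w.
  have /and3P[_ tI _] := vertices_partition G.
  by rewrite -(def_pblock tI wV h'w) (def_pblock tI vV hv).
rewrite vV /= => /negbT/existsPn/(_ h).
by rewrite he hv hb eqxx.
Qed.

End Digraph.

(* Main.v *)
Require Import Defs.
From mathcomp Require Import all_boot.

Set Implicit Arguments.
Unset Strict Implicit.
Unset Printing Implicit Defensive.

(** The conditions come in two triples, one on directed paths and one on
    composable pairs. The three conditions of a triple are contrapositive forms
    of one another: for a strict linear order on distinct edges, the negation of
    [e2] before [e3] is [e3] before [e2], and reachability is decidable. This
    argument does not look at the relation assumed between [e1] and [e2], so it
    is made once for an arbitrary relation [R] and used for both reachability
    and composability ([P2_P2r], [P2r_P2l], [P2l_P2]).

    A composable pair is a directed path, so the conditions on directed paths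
    imply those on composable pairs. Conversely ([P2_tilde_P2]), if
    [e1] precedes [e3] and [e3] precedes [e2], then a directed path from [e1]
    to [e2] starts below [e3] and ends above it. Either it meets [e3], which
    then reaches [e2], or two consecutive edges [f], [f'] of it satisfy
    [f] before [e3] before [f']. The condition on the composable pair [f], [f']
    gives that [e3] reaches [f'], hence [e2], or that [f], hence [e1], reaches
    [e3]. *)

Section Equivalence.

Variable G : digraph.
Implicit Types e f : edge G.

Local Notation "e --> e'" := (reaches e e') (at level 70, no associativity).

(** The edges form a finite type, so reachability is decidable and the
    contrapositions below need no classical axiom. *)
Lemma reaches_connect e f : reflect (e --> f) (connect (@composable G) e f).
Proof. by apply: (iffP (@connectP _ _ e f)) => -[p pth last_p]; exists p. Qed.

Lemma reaches_dec e f : e --> f \/ ~ e --> f.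
Proof. by case: (reaches_connect e f); [left | right]. Qed.

Lemma reaches_trans e f g : e --> f -> f --> g -> e --> g.
Proof.
by move=> /reaches_connect ef /reaches_connect fg;
  apply/reaches_connect; apply: connect_trans fg.
Qed.

Lemma composable_reaches e f : composable e f -> e --> f.
Proof. by move=> ef; apply/reaches_connect; apply: connect1. Qed.

Variable prec : rel (edge G).
Hypothesis prec_order : strict_linear_order prec.
Local Notation "e '≺' e'" := (prec e e') (at level 70, no associativity).

Lemma prec_asym e f : e ≺ f -> f ≺ e -> False.
Proof.
by case: prec_order => irr tr _ ef fe; move: (tr _ _ _ ef fe); rewrite irr.
Qed.

Lemma prec_total e f : e != f -> e ≺ f \/ f ≺ e.
Proof. by case: prec_order => _ _ tot /tot/orP. Qed.

Lemma prec_neq e f : e ≺ f -> e != f.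
Proof.
by case: prec_order => irr _ _; apply: contraTneq => ->; rewrite irr.
Qed.

Section Rotation.

Variable R : edge G -> edge G -> Prop.

(** With [R] taken to be [reaches], these three are convertible to [P2], [P2r],
    [P2l]; with [R] taken to be [composable], to their tilde versions. *)
Definition P2_for : Prop := forall e1 e2 e3, uniq [:: e1; e2; e3] ->
  R e1 e2 -> e1 ≺ e3 -> e3 ≺ e2 -> e3 --> e2 \/ e1 --> e3.

Definition P2r_for : Prop := forall e1 e2 e3, uniq [:: e1; e2; e3] ->
  R e1 e2 -> e1 ≺ e3 -> ~ e1 --> e3 -> e2 ≺ e3 \/ e3 --> e2.

Definition P2l_for : Prop := forall e1 e2 e3, uniq [:: e1; e2; e3] ->
  R e1 e2 -> e3 ≺ e2 -> ~ e3 --> e2 -> e3 ≺ e1 \/ e1 --> e3.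

Lemma uniq3_neq e1 e2 e3 : uniq [:: e1; e2; e3] -> (e1 != e3) * (e2 != e3).
Proof. by rewrite /= !inE negb_or => /and3P[/andP[_ ->] ->]. Qed.

Lemma P2_P2r : P2_for -> P2r_for.
Proof.
move=> H e1 e2 e3 u r12 lt13 n13.
have [|lt32] := prec_total (uniq3_neq u).2; first by left.
by case: (H _ _ _ u r12 lt13 lt32) => // r32; right.
Qed.

Lemma P2r_P2l : P2r_for -> P2l_for.
Proof.
move=> H e1 e2 e3 u r12 lt32 n32.
have [lt13|] := prec_total (uniq3_neq u).1; last by left.
have [|n13] := reaches_dec e1 e3; first by right.
by case: (H _ _ _ u r12 lt13 n13) => // /prec_asym/(_ lt32).
Qed.

Lemma P2l_P2 : P2l_for -> P2_for.
Proof.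
move=> H e1 e2 e3 u r12 lt13 lt32.
have [|n32] := reaches_dec e3 e2; first by left.
by case: (H _ _ _ u r12 lt32 n32) => [/prec_asym/(_ lt13)|]; last right.
Qed.

End Rotation.

Lemma P2_P2_tilde : P2 prec -> P2_tilde prec.
Proof. by move=> H e1 e2 e3 u /composable_reaches; apply: H. Qed.

(** The induction follows the path from its first edge: the step at which it
    passes from below [e3] to above [e3] is where the condition applies. *)
Lemma P2_tilde_P2 : P2_tilde prec -> P2 prec.
Proof.
move=> H e1 e2 e3 _ [p pth <-].
elim: p e1 pth => [|f p IH] e1 /=; first by move=> _ /prec_asym lt /lt.
case/andP=> e1f pth lt13 lt32.
have r1f := composable_reaches e1f.
have rf2 : f --> last f p by exists p.
have [<-|nf3] := eqVneq f e3; first by left.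
have [ltf3|lt3f] := prec_total nf3.
  by case: (IH f pth ltf3 lt32) => [|rf3];
    [left | right; apply: reaches_trans rf3].
have u : uniq [:: e1; f; e3].
  have [_ tr _] := prec_order.
  rewrite /= !inE negb_or nf3 (prec_neq lt13).
  by rewrite (prec_neq (tr _ _ _ lt13 lt3f)).
by case: (H _ _ _ u e1f lt13 lt3f) => [r3f|];
  [left; apply: reaches_trans rf2 | right].
Qed.

End Equivalence.

Theorem proposition3p1p6 (G : digraph) (prec : rel (edge G))
    (hprec : strict_linear_order prec) :
  [<-> P2 prec; P2r prec; P2l prec;
       P2_tilde prec; P2r_tilde prec; P2l_tilde prec].
Proof.
pose C (e f : edge G) : Prop := composable e f.
tfae.
- exact: (@P2_P2r _ _ hprec (@reaches G)).
- exact: (@P2r_P2l _ _ hprec (@reaches G)).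
- by move/(@P2l_P2 _ _ hprec (@reaches G)); apply: P2_P2_tilde.
- exact: (@P2_P2r _ _ hprec C).
- exact: (@P2r_P2l _ _ hprec C).
- by move/(@P2l_P2 _ _ hprec C); apply: P2_tilde_P2.
Qed.
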